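(* Let $B$ be a standard one-dimensional Brownian motion, let $0<\gamma<1/4$, and let $f_\gamma$ be the Cantor function on the interval $[1,2]$ associated with the middle $(1-2\gamma)$-Cantor set. Then, with positive probability, the set $\mathcal{Z}(B-f_\gamma)$ has isolated points.
   Context: $B=(B(t))_{t\ge0}$ starts at $0$. For a real function $g$ on a subset of $[0,\infty)$, $\mathcal{Z}(g)$ is the set of zeros of $g$ in $(0,\infty)$. Cantor set: let $I=[1,2]$. Let $\mathfrak{C}_{\gamma,1}$ consist of the two closed subintervals of $I$ of length $\gamma|I|$ sharing respectively the left and the right endpoint with $I$. Recursively, $\mathfrak{C}_{\gamma,n+1}$ consists of, for each $J\in\mathfrak{C}_{\gamma,n}$, the two closed subintervals of $J$ of length $\gamma^{n+1}|I|$ sharing respectively the left and the right endpoint with $J$. Let $C_{\gamma,n}$ be the union of the intervals in $\mathfrak{C}_{\gamma,n}$; the middle $(1-2\gamma)$-Cantor set is $C_\gamma=\bigcap_{n\ge1}C_{\gamma,n}$. Cantor function: $f_{\gamma,1}$ is $0$ at the left endpoint of $I$, $1$ at the right endpoint, $1/2$ on $I\setminus C_{\gamma,1}$, and linear on each interval of $\mathfrak{C}_{\gamma,1}$ (continuous). Recursively, $f_{\gamma,n+1}$ agrees with $f_{\gamma,n}$ off $C_{\gamma,n}$, and for every $J=[s,t]\in\mathfrak{C}_{\gamma,n}$ it agrees with $f_{\gamma,n}$ at $s$ and $t$, equals $(f_{\gamma,n}(s)+f_{\gamma,n}(t))/2$ on $J\setminus C_{\gamma,n+1}$ and is linear on each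 interval of $\mathfrak{C}_{\gamma,n+1}$ (continuous). The functions $f_{\gamma,n}$ converge uniformly on $I$, and $f_\gamma=\lim_n f_{\gamma,n}$. The function is extended by $f_\gamma=0$ on $[0,1)$ and $f_\gamma=1$ on $(2,\infty)$. *)

(* Defs.v *)
From HB Require Import structures.
From mathcomp Require Import all_boot all_order all_algebra.
From mathcomp Require Import all_classical all_reals all_analysis.
From mathcomp Require Import measurable_realfun.

Set Implicit Arguments.
Unset Strict Implicit.
Unset Printing Implicit Defensive.

Import Order.TTheory GRing.Theory Num.Theory.
Import numFieldNormedType.Exports.

Local Open Scope classical_set_scope.
Local Open Scope ring_scope.

Section Cantor.
Context {R : realType}.
Implicit Types (gamma x : R) (J : R * R) (g : R -> R).

(* The closed interval [s, t] is encoded by the pair (s, t).  Level 0 is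
   {[1, 2]}; since |I| = 1, the intervals of level n have length gamma ^+ n. *)
Fixpoint cantor_intervals gamma (n : nat) : seq (R * R) :=
  if n is m.+1 then
    flatten [seq [:: (J.1, J.1 + gamma ^+ m.+1); (J.2 - gamma ^+ m.+1, J.2)]
            | J <- cantor_intervals gamma m]
  else [:: (1, 2)].

(* On J = [s, t]: the continuous function equal to g at s and t, constant equal
   to (g s + g t) / 2 on ]s + l, t - l[, and linear on [s, s + l] and
   [t - l, t]. *)
Definition cantor_step g (l : R) J x : R :=
  let: (s, t) := J in
  let mid := (g s + g t) / 2 in
  if x <= s + l then g s + (mid - g s) * ((x - s) / l)
  else if x < t - l then mid
  else mid + (g t - mid) * ((x - (t - l)) / l).

(* Meaningful for x in [1, 2] and 0 < gamma < 1/2, when the intervals of each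
   level are pairwise disjoint: at most one J below contains x, and f_(n+1)
   agrees with f_n when there is none.  The recursion is started one step
   earlier than usual, from the linear function f_0 on the single interval
   [1, 2]; the first step then produces the usual f_1. *)
Fixpoint cantor_approx gamma (n : nat) : R -> R :=
  if n is m.+1 then
    fun x => foldr
      (fun J y => if J.1 <= x <= J.2
                  then cantor_step (cantor_approx gamma m) (gamma ^+ m.+1) J x
                  else y)
      (cantor_approx gamma m x) (cantor_intervals gamma m)
  else fun x => x - 1.

Definition cantor_fun gamma x : R :=
  if x < 1 then 0 else if 2 < x then 1
  else limn (fun n => cantor_approx gamma n x).

End Cantor.

Definition zeros {R : realType} (g : R -> R) : set R :=
  [set t | 0 < t /\ g t = 0].

Section Brownian.
Context {d : measure_display} {T : measurableType d} {R : realType}.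
Variable P : probability T R.

(* Taking some of the A i to be setT gives the product rule for every
   subfamily. *)
Definition mutually_independent (n : nat) (X : 'I_n -> {RV P >-> R}) : Prop :=
  forall A : 'I_n -> set R, (forall i, measurable (A i)) ->
    P (\bigcap_i (X i @^-1` A i)) = (\prod_(i < n) P (X i @^-1` A i))%E.

Definition increment (B : R -> {RV P >-> R}) (s t : R) : {RV P >-> R} :=
  B t \- B s.

(* A process on [0, +oo[ is given as a family indexed by R, of which only the
   values at nonnegative times matter.  The second argument of normal_prob is
   the standard deviation. *)
Definition is_standard_brownian_motion (B : R -> {RV P >-> R}) : Prop :=
  [/\ {ae P, forall w, B 0 w = 0},
      forall (n : nat) (t : nat -> R), 0 <= t 0%N ->
        (forall i, (i < n)%N -> t i <= t i.+1) ->
        mutually_independent (fun i : 'I_n => increment B (t i) (t i.+1)),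
      forall s t : R, 0 <= s -> s < t -> forall A : set R, measurable A ->
        distribution P (increment B s t) A = normal_prob 0 (Num.sqrt (t - s)) A &
      {ae P, forall w, {within `[0, +oo[, continuous (fun t : R => B t w)}}].

(* Avoids requiring S itself to be measurable: paths are only almost surely
   continuous, so that S may be measurable only for the completion of P.  For
   measurable S this is 0 < P S. *)
Definition with_positive_probability (S : set T) : Prop :=
  exists E : set T, [/\ measurable E, E `<=` S & (0 < P E)%E].

End Brownian.

(* Main.v *)
Require Import Defs.
From HB Require Import structures.
From mathcomp Require Import all_boot all_order all_algebra.
From mathcomp Require Import all_classical all_reals all_analysis.
From mathcomp Require Import measurable_realfun.
From mathcomp Require Import ring lra.
Import Order.TTheory GRing.Theory Num.Theory.
Import numFieldNormedType.Exports.
Local Open Scope classical_set_scope.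
Local Open Scope ring_scope.

(** Let J range over the intervals of the Cantor construction that descend from
    J_0 = [1, 1 + gamma^m], and choose theta with sqrt gamma < theta < 1/2.
    Call a path good if, for every such J of level n, B oscillates by at most
    8 theta^n on J and |B - f| > 40 theta^n at both endpoints of J.  If in
    addition 0 < B(1) < 2^-m / 2, then B - f changes sign on J_0; as B moves
    little across the gap of J, the sign change is inherited by one of the two
    children, and the resulting nested intervals shrink to a zero of B - f.  It
    is the only zero in J_0, since f varies between it and a point of J outside
    the selected child by more than B can.

    The initial condition has probability at least c 2^-m.  By union bounds over
    the 2^p intervals of level m + p, the endpoint condition fails with
    probability O(theta^m), since the density of B(t) is bounded for t >= 1 and
    2 theta < 1, and the oscillation condition fails with probability O(4^-m),
    since theta^2 > gamma and Gaussian tails decay faster than any power.  For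
    large m the good paths therefore have positive probability. *)

(** * Cantor intervals indexed by their position within a level *)

Lemma even_or_odd i : (exists k, i = k.*2) \/ (exists k, i = k.*2.+1).
Proof.
rewrite -(odd_double_half i); case: (odd i); last by left; exists i./2.
by right; exists i./2.
Qed.

(** The binary digits of [i], most significant first, record the choices of left and right child, so
    the children of interval [i] are [i.*2] and [i.*2.+1]. With this numbering the Cantor function
    takes the value [i / 2 ^ n] at the left endpoint. *)
Fixpoint cantor_left {R : realType} (gamma : R) (n i : nat) : R :=
  if n is m.+1 then
    cantor_left gamma m i./2 + (odd i)%:R * (gamma ^+ m - gamma ^+ m.+1)
  else 1.

Definition cantor_right {R : realType} (gamma : R) (n i : nat) : R :=
  cantor_left gamma n i + gamma ^+ n.

Lemma cantor_left_double {R : realType} (gamma : R) n i :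
  cantor_left gamma n.+1 i.*2 = cantor_left gamma n i.
Proof. by rewrite /= odd_double doubleK mul0r addr0. Qed.

Lemma cantor_left_doubleS {R : realType} (gamma : R) n i :
  cantor_left gamma n.+1 i.*2.+1 = cantor_right gamma n i - gamma ^+ n.+1.
Proof.
by rewrite /= odd_double uphalf_double mul1r /cantor_right addrA.
Qed.

Arguments cantor_left : simpl never.

Lemma cantor_right_double {R : realType} (gamma : R) n i :
  cantor_right gamma n.+1 i.*2 = cantor_left gamma n i + gamma ^+ n.+1.
Proof. by rewrite /cantor_right cantor_left_double. Qed.

Lemma cantor_right_doubleS {R : realType} (gamma : R) n i :
  cantor_right gamma n.+1 i.*2.+1 = cantor_right gamma n i.
Proof. by rewrite {1}/cantor_right cantor_left_doubleS subrK. Qed.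

(** Replaces the flattened list by an index, so that later inductions follow parent and child
    instead of list positions. *)
Lemma mem_cantor_intervals {R : realType} (gamma : R) n (J : R * R) :
  reflect (exists2 i, (i < 2 ^ n)%N &
             J = (cantor_left gamma n i, cantor_right gamma n i))
          (J \in cantor_intervals gamma n).
Proof.
elim: n J => [|n IHn] J /=.
  rewrite inE; apply: (iffP eqP) => [->|[i _ ->]//].
  by exists 0%N.
apply: (iffP flatten_mapP) => [[I /IHn[i i2 ->]]|[i i2 ->]].
  rewrite !inE => /orP[]/eqP -> /=.
  - exists i.*2; first by rewrite expnS mul2n ltn_double.
    by rewrite cantor_right_double cantor_left_double.
  - exists i.*2.+1; first by rewrite expnS mul2n ltn_Sdouble.
    by rewrite cantor_right_doubleS cantor_left_doubleS.
move: i2; have [[k ->]|[k ->]] := even_or_odd i; rewrite expnS mul2n.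
- rewrite ltn_double => k2.
  exists (cantor_left gamma n k, cantor_right gamma n k).
    by apply/IHn; exists k.
  by rewrite cantor_left_double cantor_right_double mem_head.
- rewrite ltn_Sdouble => k2.
  exists (cantor_left gamma n k, cantor_right gamma n k).
    by apply/IHn; exists k.
  by rewrite cantor_left_doubleS cantor_right_doubleS !inE eqxx orbT.
Qed.

(** The parents also contain [x], so they coincide by induction; since [gamma < 1 / 2], the two
    children of one interval are disjoint, and the last digits agree as well. *)
Lemma cantor_itv_uniq {R : realType} (gamma : R) n i j x :
  0 < gamma < 1 / 2 -> (i < 2 ^ n)%N -> (j < 2 ^ n)%N ->
  cantor_left gamma n i <= x <= cantor_right gamma n i ->
  cantor_left gamma n j <= x <= cantor_right gamma n j -> i = j.
Proof.
move=> /andP[g0 g1]; elim: n i j => [|n IHn] i j.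
  by rewrite expn0 !ltnS !leqn0 => /eqP -> /eqP ->.
have gn : 0 < gamma ^+ n by rewrite exprn_gt0.
have gS : gamma ^+ n.+1 * 2 < gamma ^+ n by rewrite exprS; nra.
have gS0 : 0 < gamma ^+ n.+1 by rewrite exprn_gt0.
rewrite expnS mul2n.
have [[k ->]|[k ->]] := even_or_odd i; have [[l ->]|[l ->]] := even_or_odd j;
  rewrite ?ltn_double ?ltn_Sdouble ?cantor_right_doubleS ?cantor_left_doubleS
    ?cantor_right_double ?cantor_left_double => k2 l2 xk xl;
  have E : k = l by (apply: IHn => //; move: xk xl; rewrite /cantor_right; lra).
all: by rewrite E //; exfalso; move: xk xl; rewrite E /cantor_right; lra.
Qed.

Lemma cantor_itv_ancestor {R : realType} (gamma : R) n l j x :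
  0 < gamma < 1 / 2 -> (j < 2 ^ (n + l))%N ->
  cantor_left gamma (n + l) j <= x <= cantor_right gamma (n + l) j ->
  exists2 i, (i < 2 ^ n)%N &
    cantor_left gamma n i <= x <= cantor_right gamma n i.
Proof.
move=> /andP[g0 g1]; elim: l j => [|l IHl] j; first by rewrite addn0; exists j.
rewrite addnS expnS mul2n.
have hn : 0 < gamma ^+ (n + l) by rewrite exprn_gt0.
have hS : gamma ^+ (n + l).+1 * 2 < gamma ^+ (n + l) by rewrite exprS; nra.
have [[c ->]|[c ->]] := even_or_odd j; rewrite ?ltn_double ?ltn_Sdouble => c2;
rewrite ?cantor_right_doubleS ?cantor_left_doubleS
  ?cantor_right_double ?cantor_left_double => xc;
by apply: (IHl _ c2); move: xc; rewrite /cantor_right; lra.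
Qed.

(** * The approximations on the intervals and on the gaps *)

(** The fold stops at the first listed interval containing [x], which by uniqueness is interval
    [i]. *)
Lemma cantor_approxS_in {R : realType} (gamma : R) n i x :
  0 < gamma < 1 / 2 -> (i < 2 ^ n)%N ->
  cantor_left gamma n i <= x <= cantor_right gamma n i ->
  cantor_approx gamma n.+1 x =
  cantor_step (cantor_approx gamma n) (gamma ^+ n.+1)
    (cantor_left gamma n i, cantor_right gamma n i) x.
Proof.
move=> g01 i2 xi /=.
have : (cantor_left gamma n i, cantor_right gamma n i)
    \in cantor_intervals gamma n by apply/mem_cantor_intervals; exists i.
have : {subset cantor_intervals gamma n <= cantor_intervals gamma n} by [].
(* Only the list being folded is generalised; the inclusion still ends in the full level, so that
   every interval met keeps an index and uniqueness applies to it. *)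
elim: {1 3 4}(cantor_intervals gamma n) => //= J s IHs sub.
rewrite inE; case: ifPn => [xJ _|xJ /predU1P[Ji|]].
- have /sub/mem_cantor_intervals[j j2 Jj] : J \in J :: s by rewrite mem_head.
  have -> : i = j by apply: (@cantor_itv_uniq _ gamma n _ _ x) => //; rewrite Jj in xJ.
  by rewrite Jj.
- by rewrite -Ji xi in xJ.
- by apply: IHs => K Ks; apply: sub; rewrite inE Ks orbT.
Qed.

Lemma cantor_approxS_notin {R : realType} (gamma : R) n x :
  (forall i, (i < 2 ^ n)%N ->
    ~~ (cantor_left gamma n i <= x <= cantor_right gamma n i)) ->
  cantor_approx gamma n.+1 x = cantor_approx gamma n x.
Proof.
move=> xN /=.
have : {subset cantor_intervals gamma n <= cantor_intervals gamma n} by [].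
elim: {1 3}(cantor_intervals gamma n) => //= J s IHs sub.
case: ifPn => [xJ|_]; last by apply: IHs => K Ks; apply: sub; rewrite inE Ks orbT.
have /sub/mem_cantor_intervals[j j2 Jj] : J \in J :: s by rewrite mem_head.
by have := xN _ j2; rewrite Jj /= in xJ; rewrite xJ.
Qed.

(** Over each interval of level [n] the approximation rises by [1 / 2 ^ n]; a step gives half of
    this rise to each child and none to the gap. This closed form yields the endpoint values used
    below. *)
Lemma cantor_approx_affine {R : realType} (gamma : R) n i x :
  0 < gamma < 1 / 2 -> (i < 2 ^ n)%N ->
  cantor_left gamma n i <= x <= cantor_right gamma n i ->
  cantor_approx gamma n x =
  (i%:R + (x - cantor_left gamma n i) / gamma ^+ n) / 2 ^+ n.
Proof.
move=> g01; have /andP[g0 g1] := g01.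
elim: n i x => [|n IHn] i x i2 xi.
  by move: i2; rewrite expn0 ltnS leqn0 => /eqP ->; rewrite !expr0 add0r !divr1.
have gn : 0 < gamma ^+ n by rewrite exprn_gt0.
have gS : gamma ^+ n.+1 * 2 < gamma ^+ n by rewrite exprS; nra.
have gS0 : 0 < gamma ^+ n.+1 by rewrite exprn_gt0.
have p2 : 2 ^+ n != 0 :> R by rewrite expf_neq0.
have endl k : (k < 2 ^ n)%N ->
    cantor_approx gamma n (cantor_left gamma n k) = k%:R / 2 ^+ n.
  by move=> k2; rewrite (IHn k)// ?subrr ?mul0r ?addr0 ?lexx // /cantor_right; lra.
have endr k : (k < 2 ^ n)%N ->
    cantor_approx gamma n (cantor_right gamma n k) = k.+1%:R / 2 ^+ n.
  move=> k2; rewrite (IHn k)// ?lexx ?andbT; last by rewrite /cantor_right; lra.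
  by rewrite /cantor_right addrAC subrr add0r divff ?gt_eqF// natr1.
move: i2 xi; have [[k ->]|[k ->]] := even_or_odd i; rewrite expnS mul2n.
- rewrite ltn_double cantor_right_double cantor_left_double => k2 /andP[x1 x2].
  rewrite (@cantor_approxS_in _ _ _ k)//; last by rewrite /cantor_right; lra.
  rewrite /cantor_step endl// endr// x2 -(natr1 k) -mul2n natrM [2 ^+ n.+1]exprS.
  by field; rewrite p2 gt_eqF.
- rewrite ltn_Sdouble cantor_right_doubleS cantor_left_doubleS => k2 /andP[x1 x2].
  rewrite (@cantor_approxS_in _ _ _ k)//; last first.
    by move: x1; rewrite x2 andbT /cantor_right; lra.
  rewrite /cantor_step endl// endr// ifF; last first.
    by apply/negbTE; rewrite -ltNge; move: x1; rewrite /cantor_right; lra.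
  rewrite ifF; last by apply/negbTE; rewrite -leNgt.
  rewrite -(natr1 k) -(natr1 k.*2) -mul2n natrM [2 ^+ n.+1]exprS.
  by field; rewrite p2 gt_eqF.
Qed.

Lemma cantor_approx_left {R : realType} (gamma : R) n i :
  0 < gamma < 1 / 2 -> (i < 2 ^ n)%N ->
  cantor_approx gamma n (cantor_left gamma n i) = i%:R / 2 ^+ n.
Proof.
move=> g01 i2; rewrite (@cantor_approx_affine _ _ _ i) //.
  by rewrite subrr mul0r addr0.
have /andP[g0 _] := g01.
by rewrite lexx /cantor_right lerDl exprn_ge0 // ltW.
Qed.

Lemma cantor_approx_right {R : realType} (gamma : R) n i :
  0 < gamma < 1 / 2 -> (i < 2 ^ n)%N ->
  cantor_approx gamma n (cantor_right gamma n i) = i.+1%:R / 2 ^+ n.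
Proof.
move=> g01 i2; have /andP[g0 _] := g01.
rewrite (@cantor_approx_affine _ _ _ i) //.
  rewrite /cantor_right addrAC subrr add0r divff ?gt_eqF ?exprn_gt0//.
  by rewrite natr1.
by rewrite lexx andbT /cantor_right lerDl exprn_ge0 // ltW.
Qed.

Lemma cantor_approx_itv {R : realType} (gamma : R) n i x :
  0 < gamma < 1 / 2 -> (i < 2 ^ n)%N ->
  cantor_left gamma n i <= x <= cantor_right gamma n i ->
  i%:R / 2 ^+ n <= cantor_approx gamma n x <= i.+1%:R / 2 ^+ n.
Proof.
move=> g01 i2 xi; have /andP[g0 _] := g01.
rewrite (@cantor_approx_affine _ _ _ i) //.
have gn : 0 < gamma ^+ n by rewrite exprn_gt0.
rewrite !ler_pM2r ?invr_gt0 ?exprn_gt0// -(natr1 i) lerDl lerD2l.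
rewrite ler_pdivlMr// ler_pdivrMr// mul0r mul1r.
by move: xi; rewrite /cantor_right; lra.
Qed.

(* Points of the open gap of J lie in no interval of a later level, so that all
   later approximations are constant there. *)
Lemma cantor_approx_gap {R : realType} (gamma : R) n i x k :
  0 < gamma < 1 / 2 -> (i < 2 ^ n)%N ->
  cantor_right gamma n.+1 i.*2 < x < cantor_left gamma n.+1 i.*2.+1 ->
  cantor_approx gamma (n.+1 + k) x = i.*2.+1%:R / 2 ^+ n.+1.
Proof.
move=> g01 i2 xg; have /andP[g0 g1] := g01.
have gn : 0 < gamma ^+ n by rewrite exprn_gt0.
have gS : gamma ^+ n.+1 * 2 < gamma ^+ n by rewrite exprS; nra.
have gS0 : 0 < gamma ^+ n.+1 by rewrite exprn_gt0.
have xi : cantor_left gamma n i <= x <= cantor_right gamma n i.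
  by move: xg; rewrite cantor_right_double cantor_left_doubleS /cantor_right; lra.
elim: k => [|k IHk].
  rewrite addn0 (@cantor_approxS_in _ _ _ i)// /cantor_step.
  rewrite cantor_approx_left// cantor_approx_right//.
  move: xg; rewrite cantor_right_double cantor_left_doubleS => /andP[x1 ->].
  rewrite leNgt x1 /= -(natr1 i) -(natr1 i.*2) -mul2n natrM [2 ^+ n.+1]exprS.
  by field; rewrite expf_neq0.
rewrite addnS cantor_approxS_notin// => j j2; apply/negP => xj.
have [j'] := @cantor_itv_ancestor _ _ _ _ _ _ g01 j2 xj.
rewrite expnS mul2n.
have [[c ->]|[c ->]] := even_or_odd j'; rewrite ?ltn_double ?ltn_Sdouble => c2 xc;
have E : i = c by (apply: (@cantor_itv_uniq _ gamma n _ _ x) => //;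
  move: xc; rewrite ?cantor_right_doubleS ?cantor_left_doubleS
    ?cantor_right_double ?cantor_left_double /cantor_right; lra).
all: by rewrite E in xg; lra.
Qed.

(** Induction on the number [k] of further levels, for all intervals at once: a point of a child
    falls under the induction hypothesis one level down, and a point of the gap keeps the middle
    value. *)
Lemma cantor_approx_itvD {R : realType} (gamma : R) k n i x :
  0 < gamma < 1 / 2 -> (i < 2 ^ n)%N ->
  cantor_left gamma n i <= x <= cantor_right gamma n i ->
  i%:R / 2 ^+ n <= cantor_approx gamma (n + k) x <= i.+1%:R / 2 ^+ n.
Proof.
move=> g01; elim: k n i => [|k IHk] n i i2 xi.
  by rewrite addn0 cantor_approx_itv.
have p2 : 0 < (2 ^+ n.+1)^-1 :> R by rewrite invr_gt0 exprn_gt0.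
have iE : i%:R / 2 ^+ n = i.*2%:R / 2 ^+ n.+1 :> R.
  by rewrite -mul2n natrM [2 ^+ n.+1]exprS; field; rewrite expf_neq0.
have iSE : i.+1%:R / 2 ^+ n = i.*2.+2%:R / 2 ^+ n.+1 :> R.
  rewrite -doubleS -mul2n natrM [2 ^+ n.+1]exprS.
  by field; rewrite expf_neq0.
rewrite iE iSE.
have i2' : (i.*2.+1 < 2 ^ n.+1)%N by rewrite expnS mul2n ltn_Sdouble.
have [xl|xl] := leP x (cantor_right gamma n.+1 i.*2).
  have /andP[x1 _] := xi.
  have /IHk : (i.*2 < 2 ^ n.+1)%N by exact: ltnW.
  rewrite cantor_left_double x1 xl addSnnS => /(_ isT)/andP[-> /le_trans]; apply.
  by rewrite ler_pM2r// ler_nat.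
have [xr|xr] := leP (cantor_left gamma n.+1 i.*2.+1) x.
  have /andP[_ x2] := xi.
  move/IHk : i2'; rewrite cantor_right_doubleS x2 xr addSnnS.
  move=> /(_ isT)/andP[/(le_trans _) h ->]; rewrite h//.
  by rewrite ler_pM2r// ler_nat.
rewrite -addSnnS (@cantor_approx_gap _ _ _ i)// ?xl//.
by rewrite !ler_pM2r// !ler_nat leqnSn ltnW.
Qed.

(** * The Cantor function as a limit, and its values *)

Lemma exists_expr_lt {R : realType} (z e : R) :
  0 <= z < 1 -> 0 < e -> exists n, z ^+ n < e.
Proof.
move=> /andP[z0 z1] e0.
have /cvgr0_norm_lt/(_ _ e0)[n _ /(_ n (leqnn n)) /= ne] :
    geometric (1 : R) z @ \oo --> (0 : R).
  by apply: cvg_geometric; rewrite ger0_norm.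
by exists n; move: ne; rewrite mul1r ger0_norm// exprn_ge0.
Qed.

(** If [x] lies in an interval of level [n], all values from [n] on lie in one segment of length
    [1 / 2 ^ n]; otherwise [x] lies in no later interval and the sequence is constant from [n]
    on. *)
Lemma cantor_approx_cvg {R : realType} (gamma x : R) :
  0 < gamma < 1 / 2 -> cvgn (fun n => cantor_approx gamma n x).
Proof.
move=> g01; apply/cauchy_cvgP; apply: cauchy_exP => e e0.
have [n ne] : exists n, 1 / 2 ^+ n < e :> R.
  have [||n ne] := @exists_expr_lt R 2^-1 e; [lra|exact: e0|].
  by exists n; rewrite div1r -exprVn.
have [[i i2 xi]|xN] := pselect (exists2 i, (i < 2 ^ n)%N &
    cantor_left gamma n i <= x <= cantor_right gamma n i).
  exists (i%:R / 2 ^+ n); exists n => // k /= nk; apply: le_lt_trans ne.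
  have := @cantor_approx_itvD _ gamma (k - n) n i x g01 i2 xi.
  by rewrite subnKC // -(natr1 i) mulrDl distrC ler_norml; lra.
exists (cantor_approx gamma n x); exists n => // k /= nk.
rewrite -(subnKC nk); elim: (k - n)%N => [|l IHl].
  by rewrite addn0; exact: ballxx.
rewrite addnS cantor_approxS_notin// => j j2; apply/negP => xj; apply: xN.
exact: cantor_itv_ancestor xj.
Qed.

Lemma cantor_fun_lim {R : realType} (gamma : R) n i x :
  0 < gamma < 1 / 2 -> (i < 2 ^ n)%N ->
  cantor_left gamma n i <= x <= cantor_right gamma n i ->
  cantor_fun gamma x = limn (fun n => cantor_approx gamma n x).
Proof.
move=> g01 i2 xi; have [j _] := @cantor_itv_ancestor _ _ 0 _ _ _ g01 i2 xi.
rewrite /cantor_right /cantor_left expr0 => x12.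
rewrite /cantor_fun ifF; last by lra.
by rewrite ifF; last by lra.
Qed.

Lemma cantor_fun_itv {R : realType} (gamma : R) n i x :
  0 < gamma < 1 / 2 -> (i < 2 ^ n)%N ->
  cantor_left gamma n i <= x <= cantor_right gamma n i ->
  i%:R / 2 ^+ n <= cantor_fun gamma x <= i.+1%:R / 2 ^+ n.
Proof.
move=> g01 i2 xi; rewrite (cantor_fun_lim _ _ _ _ g01 i2 xi); apply/andP; split.
  apply: limr_ge; first exact: cantor_approx_cvg.
  exists n => // k /= nk.
  by have := @cantor_approx_itvD _ gamma (k - n) n i x g01 i2 xi; rewrite subnKC // => /andP[].
apply: limr_le; first exact: cantor_approx_cvg.
exists n => // k /= nk.
by have := @cantor_approx_itvD _ gamma (k - n) n i x g01 i2 xi; rewrite subnKC // => /andP[].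
Qed.

Lemma cantor_fun_gap {R : realType} (gamma : R) n i x :
  0 < gamma < 1 / 2 -> (i < 2 ^ n)%N ->
  cantor_right gamma n.+1 i.*2 < x < cantor_left gamma n.+1 i.*2.+1 ->
  cantor_fun gamma x = i.*2.+1%:R / 2 ^+ n.+1.
Proof.
move=> g01 i2 xg; have /andP[g0 g1] := g01.
have gS0 : 0 < gamma ^+ n.+1 by rewrite exprn_gt0.
have xi : cantor_left gamma n i <= x <= cantor_right gamma n i.
  by move: xg; rewrite cantor_right_double cantor_left_doubleS /cantor_right; lra.
rewrite (cantor_fun_lim _ _ _ _ g01 i2 xi); apply: lim_near_cst => //.
exists n.+1 => // k /= nk.
by rewrite -(subnKC nk) (@cantor_approx_gap _ _ _ i).
Qed.

(** Leftmost descendants keep the left endpoint. The approximations are therefore constant there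
    from level [n] on, which gives the exact endpoint values of the limit. *)
Lemma cantor_left_expn {R : realType} (gamma : R) n k i :
  cantor_left gamma (n + k) (i * 2 ^ k) = cantor_left gamma n i.
Proof.
elim: k => [|k IHk]; first by rewrite addn0 muln1.
by rewrite addnS expnS mulnCA mul2n cantor_left_double.
Qed.

Lemma cantor_right_expn {R : realType} (gamma : R) n k i :
  cantor_right gamma (n + k) (i.+1 * 2 ^ k).-1 = cantor_right gamma n i.
Proof.
elim: k => [|k IHk]; first by rewrite addn0 muln1.
rewrite addnS expnS mulnCA mul2n.
have : (0 < i.+1 * 2 ^ k)%N by rewrite muln_gt0 expn_gt0.
move: IHk; case: (i.+1 * 2 ^ k)%N => // j IHj _.
by rewrite doubleS /= cantor_right_doubleS.
Qed.

Lemma cantor_fun_left {R : realType} (gamma : R) n i :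
  0 < gamma < 1 / 2 -> (i < 2 ^ n)%N ->
  cantor_fun gamma (cantor_left gamma n i) = i%:R / 2 ^+ n.
Proof.
move=> g01 i2; have /andP[g0 _] := g01.
rewrite (@cantor_fun_lim _ _ n i) //; last first.
  by rewrite lexx /cantor_right lerDl exprn_ge0 // ltW.
apply: lim_near_cst => //; exists n => // k /= nk.
rewrite -(subnKC nk) -(@cantor_left_expn _ _ n (k - n)) cantor_approx_left//.
  by rewrite natrM exprD natrX; field; rewrite !expf_neq0.
by rewrite expnD ltn_pmul2r// expn_gt0.
Qed.

Lemma cantor_fun_right {R : realType} (gamma : R) n i :
  0 < gamma < 1 / 2 -> (i < 2 ^ n)%N ->
  cantor_fun gamma (cantor_right gamma n i) = i.+1%:R / 2 ^+ n.
Proof.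
move=> g01 i2; have /andP[g0 _] := g01.
rewrite (@cantor_fun_lim _ _ n i) //; last first.
  by rewrite lexx andbT /cantor_right lerDl exprn_ge0 // ltW.
apply: lim_near_cst => //; exists n => // k /= nk.
have i0 : (0 < i.+1 * 2 ^ (k - n))%N by rewrite muln_gt0 expn_gt0.
rewrite -(subnKC nk) -(@cantor_right_expn _ _ n (k - n)) cantor_approx_right//.
  by rewrite prednK// natrM exprD natrX; field; rewrite !expf_neq0.
by rewrite prednK// expnD leq_pmul2r// expn_gt0.
Qed.

(** This and its mirror image below stand in for the monotonicity of the Cantor function: only
    comparison with the value on the gap is used. *)
Lemma cantor_fun_ge_mid {R : realType} (gamma : R) n i x :
  0 < gamma < 1 / 2 -> (i < 2 ^ n)%N ->
  cantor_right gamma n.+1 i.*2 < x <= cantor_right gamma n i ->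
  i.*2.+1%:R / 2 ^+ n.+1 <= cantor_fun gamma x.
Proof.
move=> g01 i2 /andP[x1 x2].
have [xr|xr] := leP (cantor_left gamma n.+1 i.*2.+1) x; last first.
  by rewrite (@cantor_fun_gap _ _ n i)// x1.
have i2' : (i.*2.+1 < 2 ^ n.+1)%N by rewrite expnS mul2n ltn_Sdouble.
suff /(cantor_fun_itv _ _ _ _ g01 i2')/andP[] :
    cantor_left gamma n.+1 i.*2.+1 <= x <= cantor_right gamma n.+1 i.*2.+1 by [].
by rewrite xr cantor_right_doubleS.
Qed.

Lemma cantor_fun_le_mid {R : realType} (gamma : R) n i x :
  0 < gamma < 1 / 2 -> (i < 2 ^ n)%N ->
  cantor_left gamma n i <= x < cantor_left gamma n.+1 i.*2.+1 ->
  cantor_fun gamma x <= i.*2.+1%:R / 2 ^+ n.+1.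
Proof.
move=> g01 i2 /andP[x1 x2].
have [xr|xr] := leP x (cantor_right gamma n.+1 i.*2); last first.
  by rewrite (@cantor_fun_gap _ _ n i)// xr.
have i2' : (i.*2 < 2 ^ n.+1)%N by rewrite expnS mul2n ltn_double.
suff /(cantor_fun_itv _ _ _ _ g01 i2')/andP[] :
    cantor_left gamma n.+1 i.*2 <= x <= cantor_right gamma n.+1 i.*2 by [].
by rewrite xr cantor_left_double x1.
Qed.

Lemma dyadic_chaining {R : realType} (b : R -> R) (a l c : R) :
  0 < l ->
  (forall j k, (k < 2 ^ j)%N ->
    `|b (a + l * (k.+1%:R / 2 ^+ j)) - b (a + l * (k%:R / 2 ^+ j))|
      <= c * (3 / 4) ^+ j) ->
  (forall t, a <= t <= a + l -> {for t, continuous b}) ->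
  forall t, a <= t <= a + l -> `|b t - b a| <= 4 * c.
Proof.
move=> l0 inc cont t ta.
(* The bound is the partial sum of [c * (3 / 4) ^+ i] over [i <= j]. *)
have dy j : forall k, (k <= 2 ^ j)%N ->
    `|b (a + l * (k%:R / 2 ^+ j)) - b a| <= 4 * c * (1 - (3 / 4) ^+ j.+1).
  have := inc 0 0 isT; rewrite !expr0 !divr1 !mulr1 mulr0 addr0 => inc0.
  elim: j => [|j IHj] k.
    rewrite expn0 expr0 divr1 expr1; case: k => [_|[_|//]].
      rewrite mulr0 addr0 subrr normr0.
      by have := le_trans (normr_ge0 _) inc0; lra.
    by rewrite mulr1; lra.
  rewrite expnS mul2n.
  have E i : i.*2%:R / 2 ^+ j.+1 = i%:R / 2 ^+ j :> R.
    by rewrite -mul2n natrM [2 ^+ j.+1]exprS; field; rewrite expf_neq0.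
  have S : (3 / 4) ^+ j.+2 = 3 / 4 * (3 / 4) ^+ j.+1 :> R by rewrite exprS.
  have r0 : 0 <= (3 / 4) ^+ j.+1 :> R by rewrite exprn_ge0//; lra.
  have c0 := le_trans (normr_ge0 _) inc0.
  have [[i ->]|[i ->]] := even_or_odd k; rewrite ?leq_double ?ltn_double => i2.
    by rewrite E; apply: le_trans (IHj _ i2) _; rewrite S; nra.
  have := inc j.+1 i.*2; rewrite expnS mul2n ltn_double => /(_ i2).
  rewrite E => h1; have h2 := IHj _ (ltnW i2).
  rewrite -[X in `|X|](subrKA (b (a + l * (i%:R / 2 ^+ j)))).
  by apply: le_trans (ler_normD _ _) _; rewrite S; lra.
apply/ler_addgt0Pr => e e0.
have /cvgrPdist_lt/(_ _ e0)/nbhs_ballP[r /= r0 br] := cont t ta.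
have [j jr] : exists j, 2^-1 ^+ j < r / l.
  by apply: exists_expr_lt; [lra|rewrite divr_gt0].
(* The last dyadic point of level [j] at or below [t]; the mesh [l / 2 ^+ j] is less than [r], so
   continuity at [t] applies to it. *)
pose k := Num.truncn ((t - a) / l * 2 ^+ j).
have u0 : 0 <= (t - a) / l by rewrite divr_ge0 ?(ltW l0)//; lra.
have u1 : (t - a) / l <= 1 by rewrite ler_pdivrMr//; lra.
have p0 : 0 < 2 ^+ j :> R by rewrite exprn_gt0.
have /andP[k1 k2] := truncn_itv (mulr_ge0 u0 (ltW p0)).
rewrite -/k in k1 k2.
have kj : (k <= 2 ^ j)%N.
  by rewrite -(ler_nat R) natrX; apply: le_trans k1 _; nra.
have v1 : k%:R / 2 ^+ j <= (t - a) / l by rewrite ler_pdivrMr.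
have v2 : (t - a) / l < k%:R / 2 ^+ j + 2^-1 ^+ j.
  have -> : k%:R / 2 ^+ j + 2^-1 ^+ j = k.+1%:R / 2 ^+ j :> R.
    by rewrite exprVn -(natr1 k) mulrDl mul1r.
  by rewrite ltr_pdivlMr.
have w1 : l * (k%:R / 2 ^+ j) <= t - a.
  by rewrite mulrC -ler_pdivlMr.
have w2 : t - a < l * (k%:R / 2 ^+ j) + r.
  rewrite -ltrBlDl; apply: lt_trans (_ : _ < l * (2^-1 ^+ j)) _.
    by move: v2; rewrite ltr_pdivrMr// => v2; nra.
  by rewrite mulrC -ltr_pdivlMr.
have := br (a + l * (k%:R / 2 ^+ j)); rewrite /ball /= => /(_ _) h.
have {}h : `|b t - b (a + l * (k%:R / 2 ^+ j))| < e by apply: h; rewrite ger0_norm; lra.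
have h2 := dy j k kj.
have c0 : 0 <= c.
  by apply: le_trans (normr_ge0 _) _; last have := inc 0 0 isT; rewrite expr0 mulr1; apply.
have r4 : 0 <= (3 / 4) ^+ j.+1 :> R by rewrite exprn_ge0//; lra.
rewrite -[X in `|X|](subrKA (b (a + l * (k%:R / 2 ^+ j)))).
by apply: le_trans (ler_normD _ _) _; nra.
Qed.

(* At a zero t of b - f lying in all the intervals J_n that are selected, f varies
   between t and the endpoints of J_(n+1) by more than the oscillation of b on
   J_n, which excludes every other zero in J_n outside J_(n+1). *)
Lemma isolated_zero_of_path {R : realType} (b : R -> R) (gamma theta : R) m :
  0 < gamma < 1 / 2 -> 1 / 4 <= theta < 1 / 2 ->
  (forall p i s t, (i < 2 ^ p)%N ->
    cantor_left gamma (m + p) i <= s <= cantor_right gamma (m + p) i ->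
    cantor_left gamma (m + p) i <= t <= cantor_right gamma (m + p) i ->
    `|b s - b t| <= 8 * theta ^+ (m + p)) ->
  (forall p i, (i < 2 ^ p)%N -> 40 * theta ^+ (m + p) <
    `|b (cantor_left gamma (m + p) i) - i%:R / 2 ^+ (m + p)|) ->
  (forall p i, (i < 2 ^ p)%N -> 40 * theta ^+ (m + p) <
    `|b (cantor_right gamma (m + p) i) - i.+1%:R / 2 ^+ (m + p)|) ->
  0 < b 1 -> b (1 + gamma ^+ m) < 1 / 2 ^+ m ->
  isolated (zeros (fun t => b t - cantor_fun gamma t)) !=set0.
Proof.
move=> g01 /andP[th4 th2] osc kl kr b1 b2; have /andP[g0 g1] := g01.
(* At level [m + p], the indices below [2 ^ p] are those of the descendants of
   [[1, 1 + gamma ^+ m]]. *)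
have lt2 p i : (i < 2 ^ p -> i < 2 ^ (m + p))%N.
  by move=> /leq_trans; apply; rewrite leq_exp2l ?leq_addl.
have L0 : cantor_left gamma m 0 = 1.
  by rewrite -[RHS](cantor_left_expn gamma 0 m 0) mul0n add0n.
pose g t := b t - cantor_fun gamma t.
have gl p i : (i < 2 ^ p)%N -> g (cantor_left gamma (m + p) i) =
    b (cantor_left gamma (m + p) i) - i%:R / 2 ^+ (m + p).
  by move=> i2; rewrite /g cantor_fun_left// lt2.
have gr p i : (i < 2 ^ p)%N -> g (cantor_right gamma (m + p) i) =
    b (cantor_right gamma (m + p) i) - i.+1%:R / 2 ^+ (m + p).
  by move=> i2; rewrite /g cantor_fun_right// lt2.
have gp n : 0 < gamma ^+ n by rewrite exprn_gt0.
have gS n : gamma ^+ n.+1 * 2 < gamma ^+ n.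
  by rewrite exprS; have := gp n; nra.
have thp n : 0 < theta ^+ n by rewrite exprn_gt0//; lra.
have thS n : theta ^+ n <= 4 * theta ^+ n.+1.
  by rewrite exprS; have := thp n; nra.
(* The function [cantor_fun] has the same value at both ends of the gap, and [b] changes there by at
   most [8 * theta ^+ n <= 32 * theta ^+ n.+1], where [n = m + p]. As [|g|] exceeds
   [40 * theta ^+ n.+1] at both ends, [g] keeps its sign. *)
have mid p i : (i < 2 ^ p)%N ->
    (0 < g (cantor_right gamma (m + p.+1) i.*2)) =
    (0 < g (cantor_left gamma (m + p.+1) i.*2.+1)).
  move=> i2.
  have i21 : (i.*2 < 2 ^ p.+1)%N by rewrite expnS mul2n ltn_double.
  have i22 : (i.*2.+1 < 2 ^ p.+1)%N by rewrite expnS mul2n ltn_Sdouble.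
  have := kr p.+1 _ i21; rewrite -gr//.
  have := kl p.+1 _ i22; rewrite -gl//.
  have : `|b (cantor_right gamma (m + p.+1) i.*2)
      - b (cantor_left gamma (m + p.+1) i.*2.+1)| <= 8 * theta ^+ (m + p).
    have := gS (m + p)%N; have := gp (m + p)%N; have := gp (m + p).+1 => ? ? ?.
    apply: (@osc p i) => //; rewrite addnS ?cantor_right_double
      ?cantor_left_doubleS /cantor_right; lra.
  have : b (cantor_right gamma (m + p.+1) i.*2)
      - b (cantor_left gamma (m + p.+1) i.*2.+1) =
      g (cantor_right gamma (m + p.+1) i.*2)
      - g (cantor_left gamma (m + p.+1) i.*2.+1).
    by rewrite gr// gl//; ring.
  move=> ->.
  set u := g _; set v := g _ => + + +; rewrite addnS; have := thS (m + p)%N.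
  have := thp (m + p)%N.
  rewrite ler_norml !lter_normr => ? ? /andP[? ?] /orP[] ? /orP[] ?;
    apply/idP/idP; lra.
(* The child is chosen by the sign of [g] at the gap so that [g] remains positive at the left
   endpoint and negative at the right one. *)
pose idx := nat_rect (fun=> nat) 0%N (fun p i =>
  if 0 < g (cantor_right gamma (m + p.+1) i.*2) then i.*2.+1 else i.*2).
pose Lf p := cantor_left gamma (m + p) (idx p).
pose Rt p := cantor_right gamma (m + p) (idx p).
have inv p : [/\ (idx p < 2 ^ p)%N, 0 < g (Lf p) & g (Rt p) < 0].
  elim: p => [|p [i2 ip jp]].
    rewrite /Lf /Rt /=; split=> //.
      by rewrite gl// addn0 L0 mul0r subr0.
    rewrite gr// addn0 /cantor_right L0; lra.
  rewrite /Lf /Rt /= -/(idx p).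
  case: ifPn => h.
    split; first by rewrite expnS mul2n ltn_Sdouble.
      by rewrite -mid.
    by rewrite addnS cantor_right_doubleS.
  have i21 : ((idx p).*2 < 2 ^ p.+1)%N by rewrite expnS mul2n ltn_double.
  split => //; first by rewrite addnS cantor_left_double.
  rewrite lt_neqAle leNgt h andbT; apply/eqP => h0.
  have := kr p.+1 _ i21; rewrite -gr// h0 normr0.
  by have := thp (m + p.+1)%N; lra.
have nest p : Lf p <= Lf p.+1 /\ Rt p.+1 <= Rt p.
  rewrite /Lf /Rt /= -/(idx p).
  have := gS (m + p)%N; have := gp (m + p)%N; have := gp (m + p).+1 => ? ? ?.
  by case: ifPn => _; rewrite addnS ?cantor_right_doubleS ?cantor_left_doubleS
    ?cantor_right_double ?cantor_left_double /cantor_right; split; lra.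
have ndL : nondecreasing_seq Lf.
  by apply/nondecreasing_seqP => p; case: (nest p).
have niR : nonincreasing_seq Rt.
  by apply/nonincreasing_seqP => p; case: (nest p).
have LR p q : Lf p <= Rt q.
  apply: le_trans (ndL _ _ (leq_maxl p q)) _.
  apply: le_trans (niR _ _ (leq_maxr p q)).
  by rewrite /Lf /Rt /cantor_right lerDl ltW.
pose t := sup (range Lf).
have Lt p : Lf p <= t.
  by apply: ub_le_sup; [exists (Rt 0) => _ [q _ <-]|exists p].
have tR p : t <= Rt p.
  by apply: ge_sup => [|_ [q _ <-]//]; exists (Lf 0), 0%N.
(* Opposite signs at the endpoints bound [|g t|] by the oscillation of [b] plus that of
   [cantor_fun], hence by [(8 + 1) / 2 ^ p]; this is the origin of [e / 9]. *)
have gt0 : g t = 0.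
  apply/eqP; rewrite -normr_eq0 eq_le normr_ge0 andbT; apply/ler_addgt0Pr => e e0.
  have [p pe] : exists p, 2^-1 ^+ p < e / 9.
    by apply: exists_expr_lt; lra.
  rewrite add0r; have [i2 gL gR] := inv p.
  have hp : 2^-1 ^+ (m + p) <= 2^-1 ^+ p :> R.
    rewrite exprD ler_piMl ?exprn_ge0 ?exprn_ile1//; lra.
  have tp : theta ^+ (m + p) <= 2^-1 ^+ (m + p).
    by rewrite lerXn2r ?nnegrE//; lra.
  have LtR : cantor_left gamma (m + p) (idx p) <= t
      <= cantor_right gamma (m + p) (idx p) by rewrite Lt tR.
  have LR' : cantor_left gamma (m + p) (idx p) <=
      cantor_right gamma (m + p) (idx p) by exact: LR.
  have := cantor_fun_itv _ _ _ _ g01 (lt2 _ _ i2) LtR.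
  have := osc _ _ t (Lf p) i2 LtR; rewrite lexx LR' => /(_ isT).
  have := osc _ _ t (Rt p) i2 LtR; rewrite lexx LR' => /(_ isT).
  move: gL gR; rewrite /Lf /Rt gl// gr// !ler_norml.
  rewrite -(natr1 (idx p)) mulrDl mul1r -exprVn /g; lra.
have Lt0 p : Lf p < t.
  rewrite lt_neqAle Lt andbT; apply/eqP => E.
  by have [_ + _] := inv p; rewrite E gt0 ltxx.
have tR0 p : t < Rt p.
  rewrite lt_neqAle tR andbT; apply/eqP => E.
  by have [_ _] := inv p; rewrite -E gt0 ltxx.
have t1 : 1 < t by have := Lt0 0%N; rewrite /Lf addn0 L0.
exists t; split.
  by rewrite inE; split => //; lra.
exists `]Lf 0%N, Rt 0%N[%classic.
  by apply: near_in_itvoo; rewrite in_itv /= Lt0 tR0.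
apply/seteqP; split => [s|s ->]; last first.
  by split; [rewrite /= in_itv /= Lt0 tR0|split => //; lra].
case; rewrite /= in_itv /= => /andP[sL sR] [s0 gs]; apply: contrapT => st.
have ex : exists p, ~~ (Lf p <= s <= Rt p).
  have st0 : 0 < `|s - t| by rewrite normr_gt0 subr_eq0; apply/eqP.
  have [p pe] : exists p, gamma ^+ p < `|s - t|.
    by apply: exists_expr_lt => //; lra.
  exists p; apply/negP => sp.
  have hp : gamma ^+ (m + p) <= gamma ^+ p.
    rewrite exprD ler_piMl ?exprn_ge0 ?exprn_ile1//; lra.
  have : `|s - t| <= gamma ^+ (m + p).
    move: sp (Lt p) (tR p); rewrite /Lf /Rt /cantor_right ler_norml; lra.
  by rewrite leNgt (le_lt_trans hp pe).
(* Level 0 contains [s], so the first interval missing [s] has a predecessor [p]: [s] lies in the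
   selected interval of level [m + p] but outside its selected child. *)
case: (ex_minnP ex) => -[|p] sp minp.
  by move/negP: sp; apply; rewrite !ltW.
have {minp} sJ : Lf p <= s <= Rt p.
  by apply: contraT => /minp; rewrite ltnn.
have [i2 gL gR] := inv p.
have [i2' gL' gR'] := inv p.+1.
have oscst : `|b s - b t| <= 8 * theta ^+ (m + p).
  by apply: osc i2 _ _ => //; rewrite Lt tR.
have tJ' : cantor_left gamma (m + p.+1) (idx p.+1) <= t
    <= cantor_right gamma (m + p.+1) (idx p.+1) by rewrite Lt tR.
have LR' : cantor_left gamma (m + p.+1) (idx p.+1) <=
    cantor_right gamma (m + p.+1) (idx p.+1) by exact: LR.
have oL := osc _ _ t (Lf p.+1) i2' tJ'.
rewrite lexx LR' in oL; have {}oL := oL isT.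
have oR := osc _ _ t (Rt p.+1) i2' tJ'.
rewrite lexx LR' in oR; have {}oR := oR isT.
have := kl _ _ i2'; rewrite -gl// -/(Lf _) gtr0_norm// => kL.
have := kr _ _ i2'; rewrite -gr// -/(Rt _) ltr0_norm// => kR.
have fL : cantor_fun gamma (Lf p.+1) = b (Lf p.+1) - g (Lf p.+1).
  by rewrite /g; ring.
have fR : cantor_fun gamma (Rt p.+1) = b (Rt p.+1) - g (Rt p.+1).
  by rewrite /g; ring.
have fs : cantor_fun gamma s = b s by apply/eqP; rewrite -subr_eq0 -opprB oppr_eq0 gs.
have := thS (m + p)%N; have := thp (m + p)%N; rewrite -addnS => th1 th3.
have {}sp : s < Lf p.+1 \/ Rt p.+1 < s.
  move: sp; rewrite negb_and -!ltNge => /orP[]; by [left|right].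
have i2m := lt2 _ _ i2.
move: oscst; rewrite ler_norml.
(* Suppose [s] lies to the left, and let [n = m + p]. Then [b s = cantor_fun gamma s <= cantor_fun
   gamma (Lf p.+1)], which is less than [b (Lf p.+1) - 40 * theta ^+ n.+1]. Passing through [t],
   however, [b] changes by at most [8 * theta ^+ n + 8 * theta ^+ n.+1], which is at most
   [(32 + 8) * theta ^+ n.+1]. The right side is symmetric. *)
case: sp => sp.
- have sf : cantor_fun gamma s <= cantor_fun gamma (Lf p.+1).
    move: sp; rewrite /Lf /= -/(idx p); case: ifPn => _.
      rewrite cantor_fun_left// ?lt2 ?expnS ?mul2n ?ltn_Sdouble//.
      rewrite addnS => sp; apply: cantor_fun_le_mid => //.
      by have /andP[-> _] := sJ.
    rewrite addnS cantor_left_double => sp.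
    by have /andP[] := sJ; rewrite /Lf leNgt sp.
  move: sf oL; rewrite ler_norml fs fL; lra.
- have sf : cantor_fun gamma (Rt p.+1) <= cantor_fun gamma s.
    move: sp; rewrite /Rt /= -/(idx p); case: ifPn => _.
      rewrite addnS cantor_right_doubleS => sp.
      by have /andP[_] := sJ; rewrite /Rt leNgt sp.
    rewrite cantor_fun_right// ?lt2 ?expnS ?mul2n ?ltn_double//.
    rewrite addnS => sp; apply: cantor_fun_ge_mid => //.
    by rewrite sp; have /andP[_ ->] := sJ.
  move: sf oR; rewrite ler_norml fs fR; lra.
Qed.

(** * Gaussian estimates *)

(** One term of the exponential series bounds [expR y] from below; this gives polynomial decay of
    any order [q]. *)
Lemma expRN_le_fact {R : realType} (y : R) q :
  0 < y -> expR (- y) <= q`!%:R / y ^+ q.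
Proof.
move=> y0; case: q => [|q].
  by rewrite expr0 divr1 -expR0 ler_expR oppr_le0 ltW.
rewrite expRN -[leRHS]invf_div.
rewrite lef_pV2 ?posrE ?expR_gt0 ?divr_gt0 ?exprn_gt0 ?ltr0n ?fact_gt0//.
by apply: le_trans (@expR_ge1Dxn R y q (ltW y0)); rewrite lerDr.
Qed.

Lemma measurable_norm_gt {R : realType} (u : R) :
  measurable [set x : R | u < `|x|].
Proof.
rewrite (_ : mkset _ = (fun x : R => `|x|) @^-1` `]u, +oo[%classic).
  by rewrite -[X in measurable X]setTI; apply: (@normr_measurable R setT).
by apply/seteqP; split => x /=; rewrite in_itv/= andbT.
Qed.

(* On |x| > u three quarters of the Gaussian exponent are traded for a constant,
   which leaves the density of a normal law of twice the standard deviation. *)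
Lemma normal_prob_tail {R : realType} (s u : R) q :
  0 < s -> 0 < u ->
  (normal_prob 0 s [set x : R | (u < `|x|)%R] <=
    (2 * (q`!%:R * (4 * s ^+ 2 / u ^+ 2) ^+ q))%:E)%E.
Proof.
move=> s0 u0; pose s2 := 2 * s.
have s20 : 0 < s2 by rewrite mulr_gt0.
have mA := measurable_norm_gt u.
have mf s' : measurable_fun setT (fun x : R => (normal_pdf 0 s' x)%:E).
  by apply/measurable_EFinP; exact: measurable_normal_pdf.
set c := (X in (_ <= X%:E)%E).
have c0 : 0 <= c.
  apply: mulr_ge0 => //; apply: mulr_ge0 => //; apply: exprn_ge0.
  by apply: divr_ge0; rewrite ?sqr_ge0// pmulr_rge0// sqr_ge0.
rewrite /normal_prob.
apply: (@le_trans _ _ (\int[lebesgue_measure]_(x in [set x : R | (u < `|x|)%R])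
   (c%:E * (normal_pdf 0 s2 x)%:E))%E).
  apply: ge0_le_integral => //.
  - by move=> x _; rewrite lee_fin normal_pdf_ge0.
  - exact: measurable_funTS (mf _).
  - apply: measurable_funTS; apply/measurable_EFinP.
    by apply: measurable_funM => //; exact: measurable_normal_pdf.
  move=> x /= ux; rewrite -EFinM lee_fin !normal_pdfE ?gt_eqF//.
  have -> : normal_peak s = 2 * normal_peak s2.
    rewrite /normal_peak /s2.
    have -> : (2 * s) ^+ 2 * pi *+ 2 = 2 ^+ 2 * (s ^+ 2 * pi *+ 2) by ring.
    rewrite [in RHS]sqrtrM ?sqr_ge0//.
    by rewrite sqrtr_sqr ger0_norm// invfM mulrA divff// mul1r.
  have -> : normal_fun 0 s x =
      expR (- (3 / 8 * (x ^+ 2 / s ^+ 2))) * normal_fun 0 s2 x.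
    rewrite /normal_fun -expRD /s2 !subr0; congr expR.
    by field; rewrite gt_eqF.
  (* For [u < |x|] the exponent [3 / 8 * (x ^+ 2 / s ^+ 2)] is at least [u ^+ 2 / (4 * s ^+ 2)], to
     which the polynomial bound is applied. *)
  have e : expR (- (3 / 8 * (x ^+ 2 / s ^+ 2))) <=
      q`!%:R * (4 * s ^+ 2 / u ^+ 2) ^+ q.
    have s2u : 0 < 4 * s ^+ 2 / u ^+ 2 by rewrite divr_gt0 ?mulr_gt0 ?exprn_gt0.
    have -> : (4 * s ^+ 2 / u ^+ 2) ^+ q = ((u ^+ 2 / (4 * s ^+ 2)) ^+ q)^-1.
      by rewrite -[in LHS]invf_div exprVn.
    apply: le_trans (expRN_le_fact _ _ _); last by rewrite -invf_div invr_gt0.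
    rewrite ler_expR lerN2.
    have ux2 : u ^+ 2 <= x ^+ 2.
      by rewrite -(real_normK (num_real x)) lerXn2r ?nnegrE// ltW.
    rewrite invfM mulrA mulrAC -[_ / 4]mulrC [leLHS]mulrC.
    have : u ^+ 2 / s ^+ 2 <= x ^+ 2 / s ^+ 2 by rewrite ler_pM2r ?invr_gt0 ?exprn_gt0.
    have : 0 <= u ^+ 2 / s ^+ 2 by rewrite divr_ge0 ?sqr_ge0.
    lra.
  have z0 := normal_fun_ge0 0 s2 x; have k0 := normal_peak_ge0 s2.
  have kz0 : 0 <= 2 * (normal_peak s2 * normal_fun 0 s2 x) by rewrite !mulr_ge0.
  by have := ler_wpM2r kz0 e; rewrite /c; congr (_ <= _); ring.
rewrite ge0_integralZl_EFin//; last 2 first.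
- by move=> x _; rewrite lee_fin normal_pdf_ge0.
- exact: measurable_funTS (mf _).
rewrite -[leRHS]mule1; apply: lee_wpmul2l; first by rewrite lee_fin.
rewrite -(@integral_normal_pdf R 0 s2); apply: ge0_subset_integral => //.
- exact: mf.
- by move=> x _; rewrite lee_fin normal_pdf_ge0.
Qed.

(** The peak of the density is at most 1 once [1 <= s]. It serves for [B t] with [1 <= t], and all
    Cantor endpoints are such times. *)
Lemma normal_prob_le_itv {R : realType} (m s u v : R) :
  1 <= s -> u <= v -> (normal_prob m s `[u, v]%classic <= (v - u)%:E)%E.
Proof.
move=> s1 uv; have s0 : 0 < s by lra.
apply: (@le_trans _ _ (1%:E * lebesgue_measure (`[u, v]%classic : set R))%E).
  rewrite -integral_cst//; apply: ge0_le_integral => //.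
  - by move=> x _; rewrite lee_fin normal_pdf_ge0.
  - apply: measurable_funTS; apply/measurable_EFinP.
    exact: measurable_normal_pdf.
  move=> x _; rewrite lee_fin (le_trans (normal_pdf_ub _ _ _))// ?gt_eqF//.
  have h : 1 <= s ^+ 2 * pi *+ 2 by have := pi_ge2 R; nra.
  rewrite invf_le1 ?sqrtr_gt0; last by lra.
  by rewrite -[leLHS]sqrtr1 ler_sqrt//; lra.
rewrite mul1e lebesgue_measure_itv/= lte_fin.
by case: ifPn => // _; rewrite lee_fin subr_ge0.
Qed.

(** On [[0, 1]] the standard normal density is at least its value at 1. *)
Lemma normal_prob_ge_itv {R : realType} (c : R) : 0 <= c <= 1 ->
  ((normal_pdf 0 1 1 * c)%:E <= normal_prob 0 1 (`]0%R, c[%classic : set R))%E.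
Proof.
move=> /andP[c0 c1].
apply: (@le_trans _ _ ((normal_pdf 0 1 1)%:E *
    lebesgue_measure (`]0%R, c[%classic : set R))%E).
  rewrite lebesgue_measure_itv/= lte_fin EFinM.
  apply: lee_wpmul2l; first by rewrite lee_fin normal_pdf_ge0.
  case: ifPn => [_|]; first by rewrite sube0.
  by rewrite -leNgt lee_fin.
rewrite -integral_cst//; apply: ge0_le_integral => //.
- by move=> x _; rewrite lee_fin normal_pdf_ge0.
- apply: measurable_funTS; apply/measurable_EFinP.
  exact: measurable_normal_pdf.
move=> x /=; rewrite in_itv/= => x01; rewrite lee_fin !normal_pdfE ?oner_eq0//.
rewrite ler_wpM2l ?normal_peak_ge0// ler_expR !subr0 !expr1n.
have x2 : x ^+ 2 <= 1 by nra.
lra.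
Qed.

(** * Union bounds over binary trees *)

Lemma sum_expr_le {R : realType} (z : R) n :
  0 <= z < 1 -> \sum_(0 <= i < n) z ^+ i <= (1 - z)^-1.
Proof.
move=> /andP[z0 z1].
have -> : \sum_(0 <= i < n) z ^+ i = (1 - z ^+ n) / (1 - z).
  elim: n => [|n IHn]; first by rewrite big_geq// expr0 subrr mul0r.
  by rewrite big_nat_recr//= IHn exprS; field; rewrite subr_eq0 gt_eqF.
by rewrite ler_piMl ?invr_ge0 ?subr_ge0 ?gerBl ?exprn_ge0// ltW.
Qed.

Lemma measurable_bigcup_tree (d : measure_display) (T : measurableType d)
    (A : nat -> nat -> set T) :
  (forall n k, measurable (A n k)) ->
  measurable (\bigcup_n \bigcup_(k < 2 ^ n) A n k).
Proof.
move=> mA; apply: bigcup_measurable => n _.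
by rewrite bigcup_mkord; apply: bigsetU_measurable.
Qed.

(** Level [n] has [2 ^ n] sets and contributes at most [c * (2 * z) ^+ n]. The bound serves both for
    the dyadic increments within one interval and for the tree of Cantor intervals. *)
Lemma measure_bigcup_tree_le (d : measure_display) (T : measurableType d)
    (R : realType) (mu : {measure set T -> \bar R})
    (A : nat -> nat -> set T) (c z : R) :
  0 <= c -> 0 <= z < 1 / 2 -> (forall n k, measurable (A n k)) ->
  (forall n k, (k < 2 ^ n)%N -> (mu (A n k) <= (c * z ^+ n)%:E)%E) ->
  (mu (\bigcup_n \bigcup_(k < 2 ^ n) A n k) <= (c / (1 - 2 * z))%:E)%E.
Proof.
move=> c0 z01 mA Ale.
have mU n : measurable (\bigcup_(k < 2 ^ n) A n k).
  by rewrite bigcup_mkord; apply: bigsetU_measurable.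
apply: le_trans (generalized_Boole_inequality mu mU _) _.
  exact: measurable_bigcup_tree.
apply: lime_le; first by apply: is_cvg_nneseries => n _ _; exact: measure_ge0.
apply: nearW => N.
have level n : (mu (\bigcup_(k < 2 ^ n) A n k) <= (c * (2 * z) ^+ n)%:E)%E.
  rewrite bigcup_mkord; apply: le_trans (Boole_inequality mu _) _ => //.
  apply: (@le_trans _ _ (\sum_(i < 2 ^ n) (c * z ^+ n)%:E)%E).
    by apply: lee_sum => i _; exact: Ale.
  rewrite sumEFin lee_fin sumr_const card_ord -[leLHS]mulr_natl natrX exprMn.
  by rewrite mulrCA mulrA.
apply: le_trans (lee_sum _ (fun n _ => level n)) _.
rewrite sumEFin lee_fin -mulr_sumr ler_wpM2l//.
by apply: sum_expr_le; lra.
Qed.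

(** * Estimates for Brownian increments *)

Lemma brownian_increment_preimage (d : measure_display)
    (T : measurableType d) (R : realType) (P : probability T R)
    (B : R -> {RV P >-> R}) (A : set R) (s t : R) :
  is_standard_brownian_motion B -> 0 <= s -> s < t -> measurable A ->
  P [set w | A (B t w - B s w)] = normal_prob 0 (Num.sqrt (t - s)) A.
Proof. by case=> _ _ h _ s0 st mA; rewrite -(h s t s0 st A mA). Qed.

Lemma measurable_brownian_increment (d : measure_display)
    (T : measurableType d) (R : realType) (P : probability T R)
    (B : R -> {RV P >-> R}) (A : set R) (s t : R) :
  measurable A -> measurable [set w | A (B t w - B s w)].
Proof.
move=> mA; rewrite -[X in measurable X]setTI.
by apply: (@measurable_funPT _ _ _ _ (increment B s t)).
Qed.

Lemma brownian_increment_tail (d : measure_display)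
    (T : measurableType d) (R : realType) (P : probability T R)
    (B : R -> {RV P >-> R}) (s t u : R) q :
  is_standard_brownian_motion B -> 0 <= s -> s < t -> 0 < u ->
  (P [set w | (u < `|B t w - B s w|)%R] <=
    (2 * (q`!%:R * (4 * (t - s) / u ^+ 2) ^+ q))%:E)%E.
Proof.
move=> hB s0 st u0.
rewrite (@brownian_increment_preimage _ _ _ _ B [set x | u < `|x|])//;
  last exact: measurable_norm_gt.
have ts : 0 < t - s by rewrite subr_gt0.
apply: le_trans (normal_prob_tail _ _ q _ u0) _; first by rewrite sqrtr_gt0.
by rewrite sqr_sqrtr// ltW.
Qed.

Lemma brownian_itv_le (d : measure_display)
    (T : measurableType d) (R : realType) (P : probability T R)
    (B : R -> {RV P >-> R}) (t v r : R) :
  is_standard_brownian_motion B -> 1 <= t -> 0 <= r ->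
  (P [set w | (B t w - B 0 w \in `[v - r, v + r])%R] <= (2 * r)%:E)%E.
Proof.
move=> hB t1 r0.
rewrite (@brownian_increment_preimage _ _ _ _ B `[v - r, v + r]%classic)//;
  last by lra.
apply: le_trans (normal_prob_le_itv _ _ _ _ _ _) _.
- by rewrite subr0 -[leLHS]sqrtr1 ler_sqrt//; lra.
- lra.
- by rewrite lee_fin; lra.
Qed.

Lemma brownian_small_ge (d : measure_display)
    (T : measurableType d) (R : realType) (P : probability T R)
    (B : R -> {RV P >-> R}) (c : R) :
  is_standard_brownian_motion B -> 0 <= c <= 1 ->
  ((normal_pdf 0 1 1 * c)%:E <= P [set w | (B 1 w - B 0 w \in `]0, c[)%R])%E.
Proof.
move=> hB c01; rewrite (@brownian_increment_preimage _ _ _ _ B `]0, c[%classic)//.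
by rewrite subr0 sqrtr1; exact: normal_prob_ge_itv.
Qed.


(** * Bad events and their probabilities *)

(** Avoiding these events for all [j] and all [k < 2 ^ j] is the increment hypothesis of
    [dyadic_chaining]. *)
Definition dyadic_jump {d : measure_display} {T : measurableType d}
    {R : realType} {P : probability T R} (B : R -> {RV P >-> R})
    (a l c : R) (j k : nat) : set T :=
  [set w | c * (3 / 4) ^+ j <
    `|B (a + l * (k.+1%:R / 2 ^+ j)) w - B (a + l * (k%:R / 2 ^+ j)) w|].

Lemma measurable_dyadic_jump (d : measure_display) (T : measurableType d)
    (R : realType) (P : probability T R) (B : R -> {RV P >-> R})
    (a l c : R) j k : measurable (dyadic_jump B a l c j k).
Proof.
apply: (@measurable_brownian_increment _ _ _ _ _ [set x | c * (3 / 4) ^+ j < `|x|]).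
exact: measurable_norm_gt.
Qed.

(* Kolmogorov's criterion with 2q-th moments: at level j the squared threshold
   decreases like (9/16)^j and the variance like 2^-j, whence the ratio 8/9. *)
Lemma dyadic_jump_prob_le (d : measure_display) (T : measurableType d)
    (R : realType) (P : probability T R) (B : R -> {RV P >-> R})
    (a gamma theta : R) n q :
  is_standard_brownian_motion B -> 0 <= a -> 0 < gamma -> 0 < theta ->
  (gamma / theta ^+ 2) ^+ q <= 1 / 4 -> (8 / 9) ^+ q <= 1 / 4 :> R ->
  (P (\bigcup_j \bigcup_(k < 2 ^ j)
        dyadic_jump B a (gamma ^+ n) (theta ^+ n) j k)
    <= (4 * (q`!%:R * 4 ^+ q) * (1 / 4) ^+ n)%:E)%E.
Proof.
move=> hB a0 g0 t0 gq q89.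
have D0 : 0 <= q`!%:R * 4 ^+ q :> R by rewrite mulr_ge0 ?exprn_ge0.
have n0 : 0 <= (1 / 4) ^+ n :> R by rewrite exprn_ge0//; lra.
have -> : 4 * (q`!%:R * 4 ^+ q) * (1 / 4) ^+ n =
    2 * (q`!%:R * 4 ^+ q) * (1 / 4) ^+ n / (1 - 2 * (1 / 4)) :> R by field.
apply: measure_bigcup_tree_le; [|lra|by move=> *; exact: measurable_dyadic_jump|].
  by rewrite mulr_ge0// mulr_ge0.
move=> j k _.
have gn : 0 < gamma ^+ n by rewrite exprn_gt0.
have p2 : 0 < 2 ^+ j :> R by rewrite exprn_gt0.
have tn : 0 < theta ^+ n by rewrite exprn_gt0.
have p3 : 0 < (3 / 4) ^+ j :> R by rewrite exprn_gt0//; lra.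
apply: le_trans (@brownian_increment_tail _ _ _ _ _ _ _ _ q hB _ _ _) _.
- by rewrite addr_ge0// mulr_ge0 ?(ltW gn)// divr_ge0// ltW.
- by rewrite ltrD2l ltr_pM2l// ltr_pM2r ?invr_gt0// ltr_nat.
- by rewrite mulr_gt0.
rewrite lee_fin -!mulrA ler_pM2l// ler_pM2l ?ltr0n ?fact_gt0//.
(* The ratio of variance to squared threshold splits into a factor in [n] and a factor in [j]; after
   raising to the power [q], each has base at most [1 / 4]. *)
have -> : 4 * ((a + (gamma ^+ n * (k.+1%:R / 2 ^+ j)) -
    (a + (gamma ^+ n * (k%:R / 2 ^+ j)))) / (theta ^+ n * (3 / 4) ^+ j) ^+ 2) =
    4 * ((gamma / theta ^+ 2) ^+ n * (8 / 9) ^+ j).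
  have E : ((3 / 4) ^+ j) ^+ 2 * 2 ^+ j * (8 / 9) ^+ j = 1 :> R.
    by rewrite exprAC -!exprMn (_ : _ * _ = 1) ?expr1n//; field.
  have nz : ((3 / 4) ^+ j) ^+ 2 * 2 ^+ j != 0 :> R.
    by rewrite gt_eqF// mulr_gt0// exprn_gt0.
  have -> : (8 / 9) ^+ j = (((3 / 4) ^+ j) ^+ 2 * 2 ^+ j)^-1 :> R.
    by rewrite -[LHS](mulKf nz) E mulr1.
  move: ((3 / 4) ^+ j) p3 {E nz} => x x0.
  rewrite expr_div_n -exprM mulnC exprM -(natr1 k).
  by field; rewrite !gt_eqF.
have rho0 : 0 <= gamma / theta ^+ 2 by rewrite divr_ge0 ?exprn_ge0 ?ltW.
rewrite exprMn ler_pM2l ?exprn_gt0// exprMn exprAC [X in _ * X]exprAC.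
move: (gamma / theta ^+ 2) rho0 gq => rho rho0 gq.
have e0 : 0 <= (8 / 9) ^+ q :> R by rewrite exprn_ge0//; lra.
have f0 : 0 <= 1 / 4 :> R by lra.
by apply: ler_pM; rewrite ?exprn_ge0 ?lerXn2r ?nnegrE ?exprn_ge0.
Qed.

Lemma cantor_left_ge1 {R : realType} (gamma : R) n i :
  0 < gamma < 1 / 2 -> 1 <= cantor_left gamma n i.
Proof.
move=> /andP[g0 g1]; elim: n i => [//|n IHn] i.
have gn : 0 < gamma ^+ n by rewrite exprn_gt0.
have gS : 0 < gamma ^+ n.+1 by rewrite exprn_gt0.
have gSn : gamma ^+ n.+1 <= gamma ^+ n by rewrite exprS; nra.
have [[k ->]|[k ->]] := even_or_odd i; have := IHn k.
  by rewrite cantor_left_double.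
by rewrite cantor_left_doubleS /cantor_right; lra.
Qed.

(** Endpoint values are measured from [B 0], because the law is given for increments and [B 0]
    vanishes only almost surely. *)
Definition bad_event {d : measure_display} {T : measurableType d}
    {R : realType} {P : probability T R} (B : R -> {RV P >-> R})
    (gamma theta : R) (n i : nat) : set T :=
  let near s v := [set w | B s w - B 0 w \in
    `[v - 40 * theta ^+ n, v + 40 * theta ^+ n]] in
  (\bigcup_j \bigcup_(k < 2 ^ j)
     dyadic_jump B (cantor_left gamma n i) (gamma ^+ n) (theta ^+ n) j k)
  `|` (near (cantor_left gamma n i) (i%:R / 2 ^+ n)
       `|` near (cantor_right gamma n i) (i.+1%:R / 2 ^+ n)).

Lemma measurable_bad_event (d : measure_display) (T : measurableType d)
    (R : realType) (P : probability T R) (B : R -> {RV P >-> R})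
    (gamma theta : R) n i : measurable (bad_event B gamma theta n i).
Proof.
apply: measurableU; last apply: measurableU.
- by apply: measurable_bigcup_tree => *; exact: measurable_dyadic_jump.
- exact: (@measurable_brownian_increment _ _ _ _ _ [set` `[_, _]]).
- exact: (@measurable_brownian_increment _ _ _ _ _ [set` `[_, _]]).
Qed.

(** Each of the two endpoint windows has length [80 * theta ^+ n], whence 160; the jumps contribute
    a multiple of [(1 / 4) ^+ n], which is at most [theta ^+ n]. *)
Lemma bad_event_prob_le (d : measure_display) (T : measurableType d)
    (R : realType) (P : probability T R) (B : R -> {RV P >-> R})
    (gamma theta : R) n i q :
  is_standard_brownian_motion B -> 0 < gamma < 1 / 2 -> 1 / 4 <= theta ->
  (gamma / theta ^+ 2) ^+ q <= 1 / 4 -> (8 / 9) ^+ q <= 1 / 4 :> R ->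
  (P (bad_event B gamma theta n i)
    <= ((160 + 4 * (q`!%:R * 4 ^+ q)) * theta ^+ n)%:E)%E.
Proof.
move=> hB g01 t4 gq q89; have /andP[g0 g1] := g01.
have t0 : 0 < theta by lra.
have tn : 0 < theta ^+ n by rewrite exprn_gt0.
have a1 := @cantor_left_ge1 _ _ n i g01.
have a2 : 1 <= cantor_right gamma n i.
  by rewrite /cantor_right; have : 0 < gamma ^+ n by [rewrite exprn_gt0]; lra.
have r0 : 0 <= 40 * theta ^+ n by rewrite mulr_ge0// ltW.
have mJ : measurable (\bigcup_j \bigcup_(k < 2 ^ j)
     dyadic_jump B (cantor_left gamma n i) (gamma ^+ n) (theta ^+ n) j k).
  by apply: measurable_bigcup_tree => *; exact: measurable_dyadic_jump.
have mN s v : measurable [set w | B s w - B 0 w \in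
    `[v - 40 * theta ^+ n, v + 40 * theta ^+ n]].
  exact: (@measurable_brownian_increment _ _ _ _ _ [set` `[_, _]]).
apply: le_trans (measureU2 _ mJ (measurableU _ _ (mN _ _) (mN _ _))) _.
have -> : (160 + 4 * (q`!%:R * 4 ^+ q)) * theta ^+ n =
   4 * (q`!%:R * 4 ^+ q) * theta ^+ n +
   (2 * (40 * theta ^+ n) + 2 * (40 * theta ^+ n)) by ring.
rewrite EFinD; apply: leeD.
  apply: le_trans (@dyadic_jump_prob_le _ _ _ _ _ _ _ _ n q hB _ _ _ gq q89) _ => //.
    by lra.
  rewrite lee_fin ler_wpM2l ?mulr_ge0 ?exprn_ge0//.
  by rewrite lerXn2r ?nnegrE//; lra.
rewrite EFinD; apply: le_trans (measureU2 _ (mN _ _) (mN _ _)) _.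
by apply: leeD; exact: brownian_itv_le.
Qed.

(** Chaining keeps the path within [4 * theta ^+ n] of its value at the left endpoint, hence any two
    values on the interval within [8 * theta ^+ n]. *)
Lemma isolated_zero_of_good_path (d : measure_display) (T : measurableType d)
    (R : realType) (P : probability T R) (B : R -> {RV P >-> R})
    (gamma theta : R) m w :
  0 < gamma < 1 / 2 -> 1 / 4 <= theta < 1 / 2 -> theta ^+ m <= 1 / 2 / 2 ^+ m ->
  B 0 w = 0 -> {within `[0, +oo[, continuous (fun t : R => B t w)} ->
  (forall p i, (i < 2 ^ p)%N -> ~ bad_event B gamma theta (m + p) i w) ->
  0 < B 1 w < 1 / 2 / 2 ^+ m ->
  isolated (zeros (fun t : R => B t w - cantor_fun gamma t)) !=set0.
Proof.
move=> g01 th thm B0 cB good B1; have /andP[g0 g1] := g01.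
have jump p i j k : (i < 2 ^ p)%N -> (k < 2 ^ j)%N ->
  `|B (cantor_left gamma (m + p) i + gamma ^+ (m + p) * (k.+1%:R / 2 ^+ j)) w -
    B (cantor_left gamma (m + p) i + gamma ^+ (m + p) * (k%:R / 2 ^+ j)) w|
  <= theta ^+ (m + p) * (3 / 4) ^+ j.
  move=> i2 k2; rewrite leNgt; apply/negP => h; apply: (good p i i2).
  by left; exists j => //; exists k.
have far x v c : x - B 0 w \notin `[v - c, v + c] -> c < `|x - v|.
  rewrite B0 subr0 in_itv/= negb_and -!ltNge lter_normr.
  by move=> /orP[] ?; apply/orP; [right|left]; lra.
(* Restricting to the open half-line turns continuity within [[0, +oo[] into two-sided continuity at
   [t]. *)
have cont t : 1 <= t -> {for t, continuous (fun t : R => B t w)}.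
  move=> t1; have : {within `]0, +oo[, continuous (fun t : R => B t w)}.
    apply: continuous_subspaceW cB => x /=; rewrite !in_itv/= !andbT; exact: ltW.
  rewrite continuous_open_subspace//; apply.
  by rewrite inE /= in_itv/= andbT; lra.
have chain p i t : (i < 2 ^ p)%N ->
    cantor_left gamma (m + p) i <= t <= cantor_right gamma (m + p) i ->
    `|B t w - B (cantor_left gamma (m + p) i) w| <= 4 * theta ^+ (m + p).
  move=> i2; apply: (@dyadic_chaining _ (fun t => B t w) _ (gamma ^+ (m + p))).
  - by rewrite exprn_gt0.
  - by move=> j k; exact: jump.
  - move=> s /andP[s1 _]; apply: cont; apply: le_trans s1.
    exact: cantor_left_ge1.
apply: (@isolated_zero_of_path _ (fun t => B t w) gamma theta m) => //.
- move=> p i s t i2 /(chain _ _ _ i2) s1 /(chain _ _ _ i2) t1.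
  by move: s1 t1; rewrite !ler_norml; lra.
- by move=> p i i2; apply: far; apply/negP => h; apply: (good p i i2); right; left.
- by move=> p i i2; apply: far; apply/negP => h; apply: (good p i i2); right; right.
- by have /andP[] := B1.
- have L0 : cantor_left gamma m 0 = 1.
    by rewrite -[RHS](cantor_left_expn gamma 0 m 0) mul0n add0n.
  (* The single jump of level 0 is the increment over the whole of [[1, 1 + gamma ^+ m]]. It is at
     most [theta ^+ m], hence at most half of [1 / 2 ^+ m], and [B 1 w] is less than the other
     half. *)
  have := jump 0%N 0%N 0%N 0%N isT isT.
  rewrite addn0 L0 !expr0 !mul0r !divr1 !mulr1 mulr0 addr0 ler_norml.
  by move: B1; lra.
Qed.

(** * Choice of the parameters and conclusion *)

Theorem proposition3p1 (R : realType) (d : measure_display)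
    (T : measurableType d) (P : probability T R)
    (B : R -> {RV P >-> R}) (gamma : R)
    (hB : is_standard_brownian_motion B)
    (hgamma : 0 < gamma < 1 / 4) :
  with_positive_probability P
    [set w | isolated (zeros (fun t : R => B t w - cantor_fun gamma t)) !=set0].
Proof.
have /andP[g0 g4] := hgamma.
have g01 : 0 < gamma < 1 / 2 by lra.
(* With this choice [theta ^+ 2 - gamma = (1 / 4 - gamma) ^+ 2], so [gamma < 1 / 4] gives both
   [gamma < theta ^+ 2] and [theta < 1 / 2]. *)
pose theta := 1 / 4 + gamma.
have t01 : 1 / 4 <= theta < 1 / 2 by rewrite /theta; lra.
have /andP[t4 t2] := t01.
have rho01 : 0 <= gamma / theta ^+ 2 < 1.
  have t20 : 0 < theta ^+ 2 by rewrite exprn_gt0//; lra.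
  rewrite divr_ge0 ?ltW//= ltr_pdivrMr// mul1r -subr_gt0.
  have -> : theta ^+ 2 - gamma = (1 / 4 - gamma) ^+ 2 by rewrite /theta; field.
  by rewrite exprn_gt0//; lra.
have [q [gq q89]] : exists q,
    (gamma / theta ^+ 2) ^+ q <= 1 / 4 /\ (8 / 9) ^+ q <= 1 / 4 :> R.
  have [||q1 h1] := @exists_expr_lt R (gamma / theta ^+ 2) (1 / 4); [exact: rho01|lra|].
  have [||q2 h2] := @exists_expr_lt R (8 / 9) (1 / 4); [lra|lra|].
  have /andP[r0 r1] := rho01.
  exists (q1 + q2)%N; rewrite !exprD; split.
    by apply: le_trans (ltW h1); rewrite ler_piMr ?exprn_ge0// exprn_ile1// ltW.
  apply: le_trans (ltW h2); rewrite ler_piMl ?exprn_ge0 ?exprn_ile1//; lra.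
pose D := 160 + 4 * (q`!%:R * 4 ^+ q) : R.
have D0 : 0 < D by rewrite ltr_pwDl// mulr_ge0// mulr_ge0// exprn_ge0.
have k0 : 0 < normal_pdf 0 1 1 :> R.
  by rewrite normal_pdfE ?oner_eq0// mulr_gt0 ?normal_peak_gt0 ?oner_eq0 ?expR_gt0.
have c0 : 0 < normal_pdf 0 1 1 * (1 / 2) * (1 - 2 * theta) / D.
  by rewrite divr_gt0// mulr_gt0 ?mulr_gt0//; lra.
(* The first bound is [theta ^+ m <= 1 / 2 / 2 ^+ m]; the second makes the total probability of the
   bad events smaller than that of the initial condition, both being compared at scale
   [1 / 2 ^+ m]. *)
have [m [m1 m2]] : exists m, (2 * theta) ^+ m <= 1 / 2 /\
    (2 * theta) ^+ m < normal_pdf 0 1 1 * (1 / 2) * (1 - 2 * theta) / D.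
  have [||n1 h1] := @exists_expr_lt R (2 * theta) (1 / 2); [lra|lra|].
  have [|n2 h2] := @exists_expr_lt R (2 * theta) _ _ c0; first by lra.
  exists (n1 + n2)%N; rewrite exprD; split.
    by apply: le_trans (ltW h1); rewrite ler_piMr ?exprn_ge0 ?exprn_ile1//; lra.
  by apply: le_lt_trans h2; rewrite ler_piMl ?exprn_ge0 ?exprn_ile1//; lra.
have p2 : 0 < 2 ^+ m :> R by rewrite exprn_gt0.
have thm : theta ^+ m <= 1 / 2 / 2 ^+ m by rewrite ler_pdivlMr// mulrC -exprMn.
have [+ _ _] := hB; case=> N0 [mN0 PN0 sN0] [N1 [mN1 PN1 sN1]].
pose S := [set w | B 1 w - B 0 w \in `]0, 1 / 2 / 2 ^+ m[].
pose Bad := \bigcup_p \bigcup_(i < 2 ^ p) bad_event B gamma theta (m + p) i.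
have mS : measurable S.
  exact: (@measurable_brownian_increment _ _ _ _ _ [set` `]_, _[]).
have mBad : measurable Bad.
  by apply: measurable_bigcup_tree => *; exact: measurable_bad_event.
have PBad : (P Bad <= (D * theta ^+ m / (1 - 2 * theta))%:E)%E.
  apply: measure_bigcup_tree_le; [|lra|by move=> *; exact: measurable_bad_event|].
    by rewrite mulr_ge0 ?exprn_ge0 ?ltW//; lra.
  move=> p i _; rewrite -mulrA -exprD; exact: bad_event_prob_le.
have mN : measurable (N0 `|` N1) by exact: measurableU.
have PN : P (N0 `|` N1) = 0%E.
  apply/eqP; rewrite eq_le measure_ge0 andbT.
  apply: le_trans (measureU2 _ mN0 mN1) _.
  by rewrite [X in (X + _)%E]PN0 [X in (_ + X)%E]PN1 adde0.
have PS : (P Bad < P S)%E.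
  apply: le_lt_trans PBad _; apply: lt_le_trans (brownian_small_ge _ _ _ _ _ _ hB _).
    rewrite lte_fin ltr_pdivrMr; last by lra.
    have -> : normal_pdf 0 1 1 * (1 / 2 / 2 ^+ m) * (1 - 2 * theta) =
        normal_pdf 0 1 1 * (1 / 2) * (1 - 2 * theta) / 2 ^+ m by ring.
    by move: m2; rewrite !ltr_pdivlMr// exprMn; congr (_ < _); ring.
  rewrite divr_ge0 ?(ltW p2)//= ler_pdivrMr// mul1r.
  by have : 1 <= 2 ^+ m :> R by [rewrite exprn_ege1// ler1n]; lra.
(* The null sets [N0] and [N1] cover the paths with [B 0 w <> 0] and the discontinuous ones;
   removing them leaves a measurable set of good paths. *)
exists (S `\` (Bad `|` (N0 `|` N1))); split.
- by apply: measurableD => //; exact: measurableU.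
- move=> w [] + /not_orP[nB] /not_orP[n0 n1] /=; rewrite /S/=.
  have B0 : B 0 w = 0 by apply: contrapT => h; apply: n0; apply: sN0.
  rewrite B0 subr0 => B1.
  apply: (@isolated_zero_of_good_path _ _ _ _ _ gamma theta m) => //.
    by apply: contrapT => h; apply: n1; apply: sN1.
  by move=> p i i2 h; apply: nB; exists p => //; exists i.
(* Were this set null, [S] would be covered by it, [Bad] and two null sets, contradicting
   [P Bad < P S]. *)
rewrite lt0e measure_ge0 andbT; apply/eqP => PE.
have : (P S <= P Bad)%E; last by rewrite leNgt PS.
set F := Bad `|` (N0 `|` N1) in PE.
have mF : measurable F by exact: measurableU.
have mE : measurable (S `\` F) by exact: measurableD.
have sS : S `<=` (S `\` F) `|` F.
  by move=> w Sw; case: (pselect (F w)) => Fw; [right|left].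
apply: le_trans (le_measure P _ _ sS) _; rewrite ?inE//; first exact: measurableU.
apply: le_trans (measureU2 _ mE mF) _.
rewrite [X in (X + _)%E]PE add0e.
by apply: le_trans (measureU2 _ mBad mN) _; rewrite [X in (_ + X)%E]PN adde0.
Qed.
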